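(* Let $G$ be a connected graph and $H$ a graph, both with at least two vertices. If at least one of $G$ and $H$ is not a complete graph, then $\chi_\mu(G\circ H)=2$.
   Context: All graphs are finite and simple. The lexicographic product $G\circ H$ has vertex set $V(G)\times V(H)$, with $(g,h)$ adjacent to $(g',h')$ iff $gg'\in E(G)$, or $g=g'$ and $hh'\in E(H)$. A geodesic is a shortest path. For $X\subseteq V(G)$, two vertices $x,y\in X$ are $X$-visible if some $x,y$-geodesic has no internal vertex in $X$; $X$ is a mutual-visibility (MV) set if every two of its vertices are $X$-visible. $\chi_\mu(G)$ is the least $k$ such that $V(G)$ can be partitioned into $k$ MV sets. *)

(* Defs.v *)
From mathcomp Require Import all_boot.

Set Implicit Arguments.
Unset Strict Implicit.
Unset Printing Implicit Defensive.

Record sgraph := SGraph {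
  vertex :> finType;
  adj : rel vertex;
  adj_sym : symmetric adj;
  adj_irrefl : irreflexive adj }.

Definition connected_graph (G : sgraph) : Prop :=
  forall x y : G, connect (@adj G) x y.

Definition complete_graph (G : sgraph) : Prop :=
  forall x y : G, x != y -> adj x y.

Section Lexicographic.
Variables G H : sgraph.

Definition lex_adj : rel (G * H) :=
  fun u v => adj u.1 v.1 || (u.1 == v.1) && adj u.2 v.2.

Lemma lex_adj_sym : symmetric lex_adj.
Proof. by move=> u v; rewrite /lex_adj adj_sym eq_sym (adj_sym u.2). Qed.

Lemma lex_adj_irrefl : irreflexive lex_adj.
Proof. by move=> u; rewrite /lex_adj !adj_irrefl andbF. Qed.

Definition lexprod : sgraph := SGraph lex_adj_sym lex_adj_irrefl.

End Lexicographic.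

Section MutualVisibility.
Variable G : sgraph.
Implicit Types (x y : G) (p : seq G) (X : {set G}) (P : {set {set G}}).

(* As in path.v, the vertex sequence of the walk is x :: p, so its length is
   size p and its internal vertices are behead (belast x p). *)
Definition walk x y p : bool := path (@adj G) x p && (last x p == y).

Definition geodesic x y p : bool :=
  walk x y p && [forall n : 'I_(size p), forall q : n.-tuple G, ~~ walk x y q].

Lemma geodesicP x y p :
  reflect (walk x y p /\ forall q, walk x y q -> size p <= size q)
          (geodesic x y p).
Proof.
apply: (iffP andP) => [[wp /forallP minp]|[wp minp]]; split=> //.
  move=> q wq; rewrite leqNgt; apply/negP => ltqp.
  by move/forallP: (minp (Ordinal ltqp)) => /(_ (in_tuple q)); rewrite wq.
apply/forallP=> n; apply/forallP=> q; apply/negP => /minp.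
by rewrite size_tuple leqNgt ltn_ord.
Qed.

Definition internal_avoids X x p : bool :=
  all [predC X] (behead (belast x p)).

(* A geodesic has no repeated vertex, so bounding its length by #|G| loses
   nothing: see visibleP. *)
Definition visible X x y : bool :=
  [exists n : 'I_#|G|, exists p : n.-tuple G,
     geodesic x y p && internal_avoids X x p].

Lemma visibleP X x y :
  reflect (exists2 p, geodesic x y p & internal_avoids X x p) (visible X x y).
Proof.
apply: (iffP existsP) => [[n /existsP[p /andP[gp ap]]]|[p gp ap]].
  by exists p.
have ltp : size p < #|G|.
  case/geodesicP: gp => /andP[pp /eqP lp] minp.
  case/shortenP: pp lp => q pq uq _ lq.
  have /minp lepq : walk x y q by rewrite /walk pq lq eqxx.
  by apply: leq_ltn_trans lepq _; have := max_card (mem (x :: q)); rewrite (card_uniqP uq).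
by exists (Ordinal ltp); apply/existsP; exists (in_tuple p); rewrite gp.
Qed.

Definition mv_set X : bool :=
  [forall x in X, forall y in X, visible X x y].

Definition mv_partition P : bool :=
  partition P [set: G] && [forall X in P, mv_set X].

Definition mv_partitionable (k : nat) : bool :=
  [exists P, mv_partition P && (#|P| == k)].

Lemma mv_partitionable_exists : exists k, mv_partitionable k.
Proof.
pose P := [set [set x] | x : G]; exists #|P|.
apply/existsP; exists P; rewrite eqxx andbT; apply/andP; split.
  apply/and3P; split.
  - apply/eqP/setP => x; rewrite inE; apply/bigcupP; exists [set x].
      exact: imset_f.
    exact: set11.
  - apply/trivIsetP => _ _ /imsetP[x _ ->] /imsetP[y _ ->] nxy.
    by rewrite disjoints1 inE; apply: contra nxy => /eqP->.
  - by apply/imsetP => -[x _] /setP/(_ x); rewrite !inE eqxx.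
apply/forall_inP => _ /imsetP[z _ ->].
apply/forall_inP => x /set1P->; apply/forall_inP => y /set1P->.
by apply/visibleP; exists [::] => //; apply/geodesicP; rewrite /walk /= eqxx.
Qed.

Definition chi_mu : nat := ex_minn mv_partitionable_exists.

End MutualVisibility.

(* Main.v *)
Require Import Defs.
From mathcomp Require Import all_boot.

(** A [G]-geodesic between two distinct fibres lifts to a geodesic of
    [lexprod G H] whose internal vertices all lie in a prescribed layer
    [G * {k}]; nonadjacent vertices of a common fibre are joined through a
    single vertex of that layer.  Hence every set missing a whole layer is a
    mutual-visibility set, and one layer together with its complement is a
    partition into two such sets.  A single class is impossible, since two
    nonadjacent vertices do not see each other through the full vertex set. *)

Lemma connect_geodesic {G : sgraph} {x y : G} :
  connect (@adj G) x y -> exists p, geodesic x y p.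
Proof.
move=> /connectP[p pp lp].
have exw : exists n, [exists q : n.-tuple G, walk x y q].
  by exists (size p); apply/existsP; exists (in_tuple p); rewrite /walk /= pp lp eqxx.
case: (ex_minnP exw) => n /existsP[q wq] minn; exists q.
apply/geodesicP; split=> // r wr; rewrite size_tuple; apply: minn.
by apply/existsP; exists (in_tuple r).
Qed.

(** The first step of a walk from [x] to any other vertex gives the neighbour. *)
Lemma connected_neighbor {G : sgraph} (x : G) :
  connected_graph G -> 1 < #|G| -> exists y, adj x y.
Proof.
move=> cG; rewrite (cardD1 x) inE /= add1n ltnS => /card_gt0P[z].
rewrite !inE andbT => nzx; case/connectP: (cG x z) => -[|y p] /=.
  by move=> _ zx; rewrite zx eqxx in nzx.
by case/andP=> xy _ _; exists y.
Qed.

(** Project to [G] and drop the steps that stay inside a fibre. This bounds lengths in the product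
    from below by distances in [G]. *)
Lemma lex_walk_proj {G H : sgraph} {u v : lexprod G H} {q} :
  walk u v q -> exists2 p, walk u.1 v.1 p & size p <= size q.
Proof.
rewrite /walk; elim: q u => [|w q IH] u /=.
  by move/eqP->; exists [::]; rewrite //= eqxx.
case/andP=> /andP[uw pq] lq; have /IH[p wp sp] : path (@adj (lexprod G H)) w q && (last w q == v) by rewrite pq.
case/orP: uw => [uw|/andP[/eqP-> _]]; last by exists p; rewrite // leqW.
by exists (w.1 :: p); rewrite //= uw.
Qed.

(** When the first coordinates are adjacent in [G], the second ones are free. *)
Lemma lex_path_lift {G H : sgraph} (k h h' : H) (g g' : G) (r : seq G) :
  path (@adj G) g (rcons r g') ->
  path (@adj (lexprod G H)) (g, h) (rcons [seq (a, k) | a <- r] (g', h')).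
Proof.
elim: r g h => [|a r IH] g h /= /andP[ga pr]; rewrite /lex_adj /= ga //=.
exact: IH.
Qed.

Lemma lex_mv_set {G H : sgraph} (k : H) (X : {set lexprod G H}) :
  connected_graph G -> 1 < #|G| -> (forall a, (a, k) \notin X) -> mv_set X.
Proof.
move=> cG cardG kX; apply/forall_inP=> -[g h] _; apply/forall_inP=> -[g' h'] _.
apply/visibleP; have [<-{g'}|ngg'] := eqVneq g g'.
  have [<-{h'}|nhh'] := eqVneq h h'.
    by exists [::] => //; apply/geodesicP; rewrite /walk /= eqxx.
  case hh': (adj h h').
    exists [:: (g, h') : lexprod G H] => //.
    apply/geodesicP; split=> [|[|//]].
      by rewrite /walk /= /lex_adj /= !eqxx hh' orbT.
    by rewrite /walk /= xpair_eqE (negPf nhh') andbF.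
  (* A neighbour [g1] of [g] makes [(g1, k)] adjacent to the whole fibre over [g], so the distance
     here is exactly 2. *)
  have [g1 gg1] := connected_neighbor g cG cardG.
  exists [:: (g1, k) : lexprod G H; (g, h')]; last by rewrite /internal_avoids /= kX.
  apply/geodesicP; split=> [|[|w [|//]]].
  - by rewrite /walk /= /lex_adj /= gg1 (adj_sym g1) gg1 eqxx.
  - by rewrite /walk /= xpair_eqE (negPf nhh') andbF.
  - rewrite /walk /= andbT => /andP[+ /eqP wE]; rewrite wE.
    by rewrite /lex_adj /= adj_irrefl hh' andbF.
have [p /geodesicP[/andP[pp /eqP lp] minp]] := connect_geodesic (cG g g').
(* Split off the endpoint: only the internal vertices [r] move to layer [k], while the end keeps its
   coordinate [h']. *)
case/lastP: p pp lp minp => [|r z] pp /=; first by move=> gg'; rewrite gg' eqxx in ngg'.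
rewrite last_rcons => zg' minp; rewrite {z}zg' in pp minp.
exists (rcons [seq (a, k) : lexprod G H | a <- r] (g', h')).
  apply/geodesicP; split=> [|q /lex_walk_proj[p /minp lep lepq]].
    by rewrite /walk last_rcons eqxx andbT; apply: lex_path_lift.
  by apply: leq_trans lepq; rewrite size_rcons size_map -(size_rcons r g').
by rewrite /internal_avoids belast_rcons /= all_map; apply/allP=> a _; apply: kX.
Qed.

Lemma mv_partitionable_C {G : sgraph} (A : {set G}) :
  A != set0 -> ~: A != set0 -> mv_set A -> mv_set (~: A) ->
  mv_partitionable G 2.
Proof.
move=> A0 CA0 mvA mvCA.
have nAC : A != ~: A.
  by apply: contraNneq A0 => eqA; rewrite -(setIid A) {2}eqA setICr.
apply/existsP; exists [set A; ~: A]; rewrite cards2 nAC eqxx andbT.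
apply/andP; split; last by apply/forall_inP=> B /set2P[]->.
apply/and3P; split.
- by rewrite /cover bigcup_setU !big_set1 setUCr.
- apply/trivIsetP=> B C /set2P[]-> /set2P[]->; rewrite ?eqxx // => _.
    by rewrite disjoints_subset setCK.
  by rewrite disjoints_subset.
- by rewrite !inE ![set0 == _]eq_sym negb_or A0.
Qed.

(** A geodesic whose internal vertices avoid the full vertex set has none, so it has at most one
    edge. *)
Lemma mv_setT_complete {G : sgraph} : mv_set [set: G] -> complete_graph G.
Proof.
move=> mvT x y nxy.
have /visibleP[[|z [|w p]]] : visible [set: G] x y.
- by move/forall_inP: mvT => /(_ x (in_setT x)) /forall_inP; apply.
- by case/geodesicP; rewrite /walk /= (negPf nxy).
- by case/geodesicP; rewrite /walk /= andbT => /andP[xz /eqP<-].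
- by rewrite /internal_avoids /= inE.
Qed.

Lemma mv_partitionable_gt1 {G : sgraph} {n : nat} :
  ~ complete_graph G -> 0 < #|G| -> mv_partitionable G n -> 1 < n.
Proof.
move=> ncG cardG /existsP[P /andP[/andP[partP mvP] /eqP <-]].
have covP := cover_partition partP; rewrite ltnNge leq_eqVlt ltnS leqn0.
(* A single block would be the full vertex set; an empty partition would cover no vertex. *)
apply/negP => /orP[/cards1P[B PB]|].
  apply: ncG; apply: mv_setT_complete; rewrite -covP PB /cover big_set1.
  by move/forall_inP: mvP; apply; rewrite PB set11.
rewrite cards_eq0 => /eqP P0.
by move: cardG; rewrite -cardsT -covP P0 /cover big_set0 cards0.
Qed.

(** Each layer is an induced copy of [G], and each fibre one of [H]. *)
Lemma lex_complete {G H : sgraph} :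
  0 < #|G| -> 0 < #|H| -> complete_graph (lexprod G H) ->
  complete_graph G /\ complete_graph H.
Proof.
move=> /card_gt0P[g _] /card_gt0P[h _] cGH; split=> x y nxy.
  have /= := cGH (x, h) (y, h); rewrite xpair_eqE eqxx andbT nxy => /(_ isT).
  by rewrite /lex_adj /= adj_irrefl andbF orbF.
have /= := cGH (g, x) (g, y); rewrite xpair_eqE eqxx nxy => /(_ isT).
by rewrite /lex_adj /= adj_irrefl eqxx.
Qed.

Theorem theorem4p12 (G H : sgraph) :
  connected_graph G -> 1 < #|G| -> 1 < #|H| ->
  ~ complete_graph G \/ ~ complete_graph H ->
  chi_mu (lexprod G H) = 2.
Proof.
move=> cG cardG cardH ncGH.
have G0 := ltnW cardG; have H0 := ltnW cardH.
have ncL : ~ complete_graph (lexprod G H).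
  by move=> /(lex_complete G0 H0)[cGc cHc]; case: ncGH.
have [g _] := card_gt0P G0.
have [h [k [_ _ nhk]]] := card_gt1P cardH.
have p2 : mv_partitionable (lexprod G H) 2.
  pose A : {set lexprod G H} := [set u | u.2 == h].
  apply: (mv_partitionable_C A).
  - by apply/set0Pn; exists (g, h); rewrite inE eqxx.
  - by apply/set0Pn; exists (g, k); rewrite !inE /= eq_sym.
  (* The layer [A] over [h] misses layer [k], and its complement misses layer [h]. *)
  - by apply: (lex_mv_set k) => // a; rewrite inE /= eq_sym.
  - by apply: (lex_mv_set h) => // a; rewrite !inE /= eqxx.
rewrite /chi_mu; case: ex_minnP => n pn /(_ 2 p2) len2.
apply/eqP; rewrite eqn_leq len2; apply: mv_partitionable_gt1 ncL _ pn.
by rewrite card_prod muln_gt0 G0.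
Qed.
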